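(* For all integers $n \ge 1$ and $m \ge 0$, the value $$\psi^{(n)}(-m) := -\mathop{\mathrm{N\!-\!lim}}_{\varepsilon\to 0}\int_\varepsilon^1 \frac{t^{-m-1}}{1-t}\,\ln^n t\,dt$$ exists (i.e. the neutrix limit exists), and $$\psi^{(n)}(-m)=\sum_{i=1}^m\frac{n!}{i^{n+1}}+(-1)^{n+1}\,n!\,\zeta(n+1),$$ where $\zeta$ denotes the Riemann zeta function and the sum is empty (equal to $0$) when $m=0$.
   Context: Neutrix limit. Let $N$ be the set of negligible functions on the domain $\{\varepsilon : 0<\varepsilon<\tfrac12\}$ with real values: $N$ consists of all functions that are sums of a finite (real) linear combination of the functions $$\varepsilon^{\lambda}\ln^{r-1}\varepsilon,\qquad \ln^r\varepsilon\qquad(\lambda<0 \text{ real},\ r=1,2,\ldots)$$ and a function $f(\varepsilon)$ that converges to zero in the usual sense as $\varepsilon\to 0^+$. For a real-valued function $f$ on this domain, if there is a constant $c$ such that $f(\varepsilon)-c$ belongs to $N$, then $c$ is called the neutrix limit of $f(\varepsilon)$ as $\varepsilon\to 0$, written $\mathop{\mathrm{N\!-\!lim}}_{\varepsilon\to 0} f(\varepsilon)=c$, and the neutrix limit is said to exist. Polygamma function. For $x>0$ and $n\ge 1$ the polygamma function satisfies $\psi^{(n)}(x)=\frac{d^{n+1}}{dx^{n+1}}\ln\Gamma(x)=-\int_0^1\frac{t^{x-1}\ln^n t}{1-t}\,dt$. It is extended to all real $x$, for $n\ge1$, by $\psi^{(n)}(x)=-\mathop{\mathrm{N\!-\!lim}}_{\varepsilon\to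 0}\int_\varepsilon^1\frac{t^{x-1}}{1-t}\ln^n t\,dt$ (the integrand is integrable near $t=1$). Here $\ln^n t=(\ln t)^n$. *)

(* Defs.v *)
From Stdlib Require Import Reals List ClassicalEpsilon.
From Coquelicot Require Import Coquelicot.
Open Scope R_scope.

Inductive neutrix_generator : (R -> R) -> Prop :=
| neutrix_generator_pow_ln (lam : R) (r : nat) :
    lam < 0 -> (1 <= r)%nat ->
    neutrix_generator (fun eps => Rpower eps lam * ln eps ^ (r - 1))
| neutrix_generator_ln (r : nat) :
    (1 <= r)%nat ->
    neutrix_generator (fun eps => ln eps ^ r).

Definition lin_comb (l : list (R * (R -> R))) (eps : R) : R :=
  fold_right (fun p s => fst p * snd p eps + s) 0 l.

(* Functions on the domain 0 < eps < 1/2 are represented by total functions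
   R -> R of which only the values on that domain matter. *)
Definition negligible (h : R -> R) : Prop :=
  exists (l : list (R * (R -> R))) (g : R -> R),
    List.Forall (fun p => neutrix_generator (snd p)) l /\
    filterlim g (at_right 0) (locally 0) /\
    (forall eps, 0 < eps < 1 / 2 -> h eps = lin_comb l eps + g eps).

Definition is_Nlim (f : R -> R) (c : R) : Prop :=
  negligible (fun eps => f eps - c).

Definition ex_Nlim (f : R -> R) : Prop := exists c, is_Nlim f c.

(* Arbitrary when the neutrix limit does not exist. *)
Definition Nlim (f : R -> R) : R := epsilon (inhabits 0) (is_Nlim f).

(* For n >= 1 the integrand is bounded on (eps, 1) and continuous there, so the
   Riemann integral exists whatever value the integrand is given at t = 1. *)
Definition polygamma_integral (n : nat) (x eps : R) : R :=
  RInt (fun t => Rpower t (x - 1) / (1 - t) * ln t ^ n) eps 1.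

(* Meant for n >= 1 and arbitrary real x. *)
Definition polygamma (n : nat) (x : R) : R := - Nlim (polygamma_integral n x).

(* Meant for s > 1, where the series converges. *)
Definition zeta (s : R) : R := Series (fun k => / Rpower (INR (S k)) s).

(* Main.v *)
Require Import Defs.
From Stdlib Require Import Reals Factorial List Lra Lia FunctionalExtensionality ClassicalEpsilon.
From Coquelicot Require Import Coquelicot.
Open Scope R_scope.

(* Uniqueness of the neutrix limit: put [eps = exp (- x)], so that the
   generators become [exp (a x) (- x)^k] with [a > 0], and [(- x)^r].  The
   operators [f(2x) - 2^r f(x)] kill the latter and map exponential polynomials
   to exponential polynomials, which the operators [f(x+1) - e^a f(x)] kill in
   turn.  Each such operator [f(s x) - q f(x)] multiplies limits at infinity by
   [1 - q <> 0], so a combination of generators that converges has limit 0.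

   Value: [t^(-m-1) / (1 - t)] is the sum of [t^(-k-1)] for [k <= m] and
   [1 / (1 - t)].  Explicit primitives give [- n! / k^(n+1)] for the terms with
   [k >= 1] and [0] for [k = 0], while expanding [1 / (1 - t)] into [N] geometric
   terms gives [(-1)^n n! zeta(n+1)] with a remainder of at most
   [(n-1)! / N^n], uniformly in [eps]. *)

(** * Uniqueness of the neutrix limit *)

Definition qdiff (s : R -> R) (q : R) (f : R -> R) : R -> R :=
  fun x => f (s x) - q * f x.

(** The restriction [1 < q] keeps the factor [1 - q] on limits nonzero. [Z] is a parameter so that
    classes can be nested: dilations leading into a class defined by translations. *)
Inductive annihilable (s : R -> R) (Z : (R -> R) -> Prop) : (R -> R) -> Prop :=
| annihilable_base f : Z f -> annihilable s Z f
| annihilable_step q f :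
    1 < q -> annihilable s Z (qdiff s q f) -> annihilable s Z f.

Definition qdiff_stable (s : R -> R) (Z : (R -> R) -> Prop) : Prop :=
  (forall f g, Z f -> Z g -> Z (fun x => f x + g x)) /\
  (forall c f, Z f -> Z (fun x => c * f x)) /\
  (forall q f, 1 < q -> Z f -> Z (qdiff s q f)).

Lemma annihilable_scal s Z c f :
  qdiff_stable s Z -> annihilable s Z f -> annihilable s Z (fun x => c * f x).
Proof.
  intros (_ & HZ & _) Hf.
  induction Hf as [f Hf | q f Hq _ IH].
  - now apply annihilable_base, HZ.
  - apply annihilable_step with q; [exact Hq|].
    replace (qdiff s q (fun x => c * f x)) with (fun x => c * qdiff s q f x); [exact IH|].
    apply functional_extensionality; intros x; unfold qdiff; ring.
Qed.

Lemma annihilable_qdiff s Z q f :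
  qdiff_stable s Z -> 1 < q -> annihilable s Z f -> annihilable s Z (qdiff s q f).
Proof.
  intros (_ & _ & HZ) Hq Hf.
  induction Hf as [f Hf | q' f Hq' _ IH].
  - now apply annihilable_base, HZ.
  - apply annihilable_step with q'; [exact Hq'|].
    replace (qdiff s q' (qdiff s q f)) with (qdiff s q (qdiff s q' f)); [exact IH|].
    apply functional_extensionality; intros x; unfold qdiff; ring.
Qed.

(** The operators of [f] are applied to the sum first; [g] survives each of them because operators
    with the same [s] commute. Then those of [g] are applied, and [f] stays in [Z] by stability. *)
Lemma annihilable_plus s Z f g :
  qdiff_stable s Z -> annihilable s Z f -> annihilable s Z g ->
  annihilable s Z (fun x => f x + g x).
Proof.
  intros HZ Hf; revert g.
  assert (Hplus : forall q f g,
    qdiff s q (fun x => f x + g x) = (fun x => qdiff s q f x + qdiff s q g x)).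
  { intros q f1 f2; apply functional_extensionality; intros x; unfold qdiff; ring. }
  induction Hf as [f Hf | q f Hq _ IH]; intros g Hg.
  - revert f Hf; induction Hg as [g Hg | q g Hq _ IH]; intros f Hf.
    + now apply annihilable_base, HZ.
    + apply annihilable_step with q; [exact Hq|].
      rewrite Hplus; apply IH; now apply HZ.
  - apply annihilable_step with q; [exact Hq|].
    rewrite Hplus; apply IH; now apply annihilable_qdiff.
Qed.

Lemma annihilable_lim s Z f c :
  filterlim s (Rbar_locally p_infty) (Rbar_locally p_infty) ->
  (forall f c, Z f -> is_lim f p_infty (Finite c) -> c = 0) ->
  annihilable s Z f -> is_lim f p_infty (Finite c) -> c = 0.
Proof.
  intros Hs HZ Hf; revert c.
  induction Hf as [f Hf | q f Hq _ IH]; intros c Hc.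
  - now apply (HZ f).
  - enough (c - q * c = 0) by nra.
    apply IH; unfold qdiff.
    apply (is_lim_minus' (fun x => f (s x)) (fun x => q * f x)).
    + exact (filterlim_comp _ _ _ s f _ _ _ Hs Hc).
    + exact (is_lim_scal_l f q p_infty (Finite c) Hc).
Qed.

(** * Exponential polynomials and translations *)

Definition is_null (f : R -> R) : Prop := forall x, f x = 0.

Definition translation_annihilable : (R -> R) -> Prop :=
  annihilable (fun x => x + 1) is_null.

Lemma is_null_stable s : qdiff_stable s is_null.
Proof.
  split; [|split].
  - intros f g Hf Hg x; rewrite Hf, Hg; ring.
  - intros c f Hf x; rewrite Hf; ring.
  - intros q f _ Hf x; unfold qdiff; rewrite !Hf; ring.
Qed.

(** Shifts commute with the operator; under [x -> 2 * x] a unit step moves the argument by 2, so the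
    factor [q] becomes its square, still above 1. The case [a = 2] is what lets dilations act on
    this class. *)
Lemma translation_annihilable_comp_affine a b f :
  (a = 1 \/ a = 2) ->
  translation_annihilable f -> translation_annihilable (fun x => f (a * x + b)).
Proof.
  intros Ha Hf; revert b.
  induction Hf as [f Hf | q f Hq _ IH]; intros b.
  - apply annihilable_base; intros x; apply Hf.
  - destruct Ha as [-> | ->].
    + apply annihilable_step with q; [exact Hq|].
      replace (qdiff _ q _) with (fun x => qdiff (fun x => x + 1) q f (1 * x + b)); [apply IH|].
      apply functional_extensionality; intros x; unfold qdiff.
      do 2 f_equal; ring.
    + (* [S^2 - q^2 = (S - q) (S + q)] for the unit translation [S] *)
      apply annihilable_step with (q * q); [nra|].
      replace (qdiff _ (q * q) _) with
        (fun x => qdiff (fun x => x + 1) q f (2 * x + (b + 1))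
                  + q * qdiff (fun x => x + 1) q f (2 * x + b)).
      * apply annihilable_plus; [apply is_null_stable | apply IH |].
        apply annihilable_scal; [apply is_null_stable | apply IH].
      * apply functional_extensionality; intros x; unfold qdiff.
        replace (2 * x + (b + 1) + 1) with (2 * (x + 1) + b) by ring.
        replace (2 * x + (b + 1)) with (2 * x + b + 1) by ring.
        ring.
Qed.

Lemma translation_annihilable_stable :
  qdiff_stable (fun x => 2 * x) translation_annihilable.
Proof.
  split; [|split].
  - intros f g; apply annihilable_plus, is_null_stable.
  - intros c f; apply annihilable_scal, is_null_stable.
  - intros q f _ Hf.
    replace (qdiff _ q f) with (fun x => f (2 * x + 0) + (- q) * f x).
    + apply annihilable_plus; [apply is_null_stable | |].
      * apply translation_annihilable_comp_affine; auto.
      * apply annihilable_scal; [apply is_null_stable | exact Hf].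
    + apply functional_extensionality; intros x; unfold qdiff.
      rewrite Rplus_0_r; ring.
Qed.

(** A Leibniz rule: with [S] the unit translation, [(S - q) (x f) = x (S - q) f + S f]. *)
Lemma translation_annihilable_mul_id f :
  translation_annihilable f -> translation_annihilable (fun x => x * f x).
Proof.
  intros Hf; induction Hf as [f Hf | q f Hq Hf IH].
  - apply annihilable_base; intros x; rewrite (Hf x); ring.
  - apply annihilable_step with q; [exact Hq|].
    replace (qdiff _ q _) with
      (fun x => x * qdiff (fun x => x + 1) q f x + f (1 * x + 1)).
    + apply annihilable_plus; [apply is_null_stable | exact IH |].
      apply translation_annihilable_comp_affine; auto.
      now apply annihilable_step with q.
    + apply functional_extensionality; intros x; unfold qdiff.
      rewrite Rmult_1_l; ring.
Qed.

Lemma translation_annihilable_exp_pow a k :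
  0 < a -> translation_annihilable (fun x => exp (a * x) * (- x) ^ k).
Proof.
  intros Ha; induction k as [|k IH].
  - apply annihilable_step with (exp a).
    + rewrite <- exp_0; now apply exp_increasing.
    + apply annihilable_base; intros x; unfold qdiff; simpl.
      replace (a * (x + 1)) with (a + a * x) by ring.
      rewrite exp_plus; ring.
  - replace (fun x => exp (a * x) * (- x) ^ S k) with
      (fun x => (-1) * (x * (exp (a * x) * (- x) ^ k))).
    + apply annihilable_scal; [apply is_null_stable|].
      now apply translation_annihilable_mul_id.
    + apply functional_extensionality; intros x; simpl; ring.
Qed.

(** * Generators in the variable [eps = exp (- x)] *)

(** Killing [(- x) ^ r] by translations would take [q = 1], which loses the limit. Homogeneity gives
    a dilation factor [2 ^ r] instead, above 1 since [1 <= r]. *)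
Lemma generator_annihilable g :
  neutrix_generator g ->
  annihilable (fun x => 2 * x) translation_annihilable (fun x => g (exp (- x))).
Proof.
  intros [lam r Hlam Hr | r Hr].
  - apply annihilable_base.
    replace (fun x => _) with (fun x => exp ((- lam) * x) * (- x) ^ (r - 1)).
    + apply translation_annihilable_exp_pow; lra.
    + apply functional_extensionality; intros x; unfold Rpower.
      rewrite ln_exp; do 2 f_equal; ring.
  - apply annihilable_step with (2 ^ r).
    + apply Rlt_pow_R1; [lra | lia].
    + apply annihilable_base, annihilable_base; intros x; unfold qdiff.
      rewrite !ln_exp.
      replace (- (2 * x)) with (2 * - x) by ring.
      rewrite Rpow_mult_distr; ring.
Qed.

Lemma lin_comb_annihilable l :
  List.Forall (fun p => neutrix_generator (snd p)) l ->
  annihilable (fun x => 2 * x) translation_annihilable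
    (fun x => lin_comb l (exp (- x))).
Proof.
  intros Hl; induction Hl as [|p l Hp _ IH].
  - now apply annihilable_base, annihilable_base; intros x.
  - apply (annihilable_plus _ _ (fun x => fst p * snd p (exp (- x))));
      [apply translation_annihilable_stable | | exact IH].
    apply annihilable_scal; [apply translation_annihilable_stable|].
    now apply generator_annihilable.
Qed.

Lemma lin_comb_lim l c :
  List.Forall (fun p => neutrix_generator (snd p)) l ->
  is_lim (fun x => lin_comb l (exp (- x))) p_infty (Finite c) -> c = 0.
Proof.
  intros Hl; apply annihilable_lim with (3 := lin_comb_annihilable l Hl).
  - intros P [M HM]; exists (Rmax M 0); intros x Hx; apply HM.
    pose proof (Rmax_l M 0); pose proof (Rmax_r M 0); lra.
  (* After the dilations, the translations are peeled off in the same way, down to the zero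
     function. *)
  - intros f c' Hf; apply annihilable_lim with (3 := Hf).
    + intros P [M HM]; exists M; intros x Hx; apply HM; lra.
    + intros g c'' Hg Hlim.
      apply is_lim_ext with (g := fun _ => 0) in Hlim; [|exact Hg].
      pose proof (is_lim_unique _ _ _ Hlim) as H.
      rewrite Lim_const in H; now injection H.
Qed.

(** If [c] is a combination of generators plus a function tending to 0, then that combination tends
    to [c], so [lin_comb_lim] applies. *)
Lemma negligible_const c : negligible (fun _ => c) -> c = 0.
Proof.
  intros (l & g & Hl & Hg & Heq).
  apply (lin_comb_lim l); [exact Hl|].
  assert (He : filterlim (fun x => exp (- x)) (Rbar_locally p_infty) (at_right 0)).
  { intros P [d Hd]; exists (- ln d); intros x Hx; apply Hd; [|apply exp_pos].
    change (Rabs (exp (- x) - 0) < d).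
    rewrite Rminus_0_r, Rabs_pos_eq by (left; apply exp_pos).
    rewrite <- (exp_ln d) by apply cond_pos; apply exp_increasing; lra. }
  apply is_lim_ext_loc with (fun x => c - g (exp (- x))).
  (* Beyond [ln 2] the point [exp (- x)] lies below [1 / 2], inside the domain of the
     decomposition. *)
  - exists (ln 2); intros x Hx.
    rewrite (Heq (exp (- x))); [ring|]; split; [apply exp_pos|].
    replace (1 / 2) with (exp (- ln 2)); [apply exp_increasing; lra|].
    rewrite exp_Ropp, exp_ln; lra.
  - replace (Finite c) with (Finite (c - 0)) by (f_equal; ring).
    apply (is_lim_minus' (fun _ => c) (fun x => g (exp (- x)))); [apply is_lim_const|].
    exact (filterlim_comp _ _ _ _ g _ _ _ He Hg).
Qed.

(** * Linear structure of the negligible functions *)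

Lemma lin_comb_app l1 l2 eps :
  lin_comb (l1 ++ l2) eps = lin_comb l1 eps + lin_comb l2 eps.
Proof.
  induction l1 as [|p l1 IH]; unfold lin_comb in *; simpl; [ring | rewrite IH; ring].
Qed.

Lemma lin_comb_scal a l eps :
  lin_comb (List.map (fun p => (a * fst p, snd p)) l) eps = a * lin_comb l eps.
Proof.
  induction l as [|p l IH]; unfold lin_comb in *; simpl; [ring | rewrite IH; ring].
Qed.

Lemma negligible_ext f g :
  (forall eps, 0 < eps < 1 / 2 -> f eps = g eps) -> negligible f -> negligible g.
Proof.
  intros Heq (l & h & Hl & Hh & Hf); exists l, h; repeat split; auto.
  intros eps Heps; rewrite <- Heq; auto.
Qed.

Lemma is_Nlim_lim (f : R -> R) (c : R) :
  filterlim f (at_right 0) (locally c) -> is_Nlim f c.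
Proof.
  intros Hf; exists nil, (fun eps => f eps - c); repeat split; auto.
  - apply filterlim_locally; intros e.
    generalize (proj1 (filterlim_locally _ _) Hf e); apply filter_imp; intros t Ht.
    change (Rabs (f t - c) < e) in Ht.
    change (Rabs (f t - c - 0) < e); now rewrite Rminus_0_r.
  - intros eps _; unfold lin_comb; simpl; ring.
Qed.

Lemma negligible_generator g : neutrix_generator g -> negligible g.
Proof.
  intros Hg; exists ((1, g) :: nil), (fun _ => 0); repeat split; auto.
  - apply filterlim_const.
  - intros eps _; unfold lin_comb; simpl; ring.
Qed.

Lemma filterlim_plus_0 {T : Type} {F : (T -> Prop) -> Prop} {FF : Filter F} (f g : T -> R) :
  filterlim f F (locally 0) -> filterlim g F (locally 0) ->
  filterlim (fun x => f x + g x) F (locally 0).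
Proof.
  intros Hf Hg.
  rewrite <- (Rplus_0_r 0).
  exact (filterlim_comp_2 _ _ plus Hf Hg (filterlim_plus 0 0)).
Qed.

Lemma filterlim_mult_0 {T : Type} {F : (T -> Prop) -> Prop} {FF : Filter F} (f g : T -> R) :
  filterlim f F (locally 0) -> filterlim g F (locally 0) ->
  filterlim (fun x => f x * g x) F (locally 0).
Proof.
  intros Hf Hg.
  rewrite <- (Rmult_0_r 0).
  exact (filterlim_comp_2 _ _ mult Hf Hg (filterlim_mult 0 0)).
Qed.

Lemma filterlim_scal_0 {T : Type} {F : (T -> Prop) -> Prop} {FF : Filter F} (a : R) (f : T -> R) :
  filterlim f F (locally 0) -> filterlim (fun x => a * f x) F (locally 0).
Proof.
  intros Hf.
  rewrite <- (Rmult_0_r a).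
  exact (filterlim_comp _ _ _ f (scal a) _ _ _ Hf (filterlim_scal_r a 0)).
Qed.

Lemma negligible_plus f g :
  negligible f -> negligible g -> negligible (fun eps => f eps + g eps).
Proof.
  intros (l1 & h1 & Hl1 & Hh1 & Hf) (l2 & h2 & Hl2 & Hh2 & Hg).
  exists (l1 ++ l2), (fun eps => h1 eps + h2 eps); repeat split.
  - now apply Forall_app.
  - now apply filterlim_plus_0.
  - intros eps Heps; rewrite lin_comb_app, Hf, Hg by exact Heps; ring.
Qed.

Lemma negligible_scal a f : negligible f -> negligible (fun eps => a * f eps).
Proof.
  intros (l & h & Hl & Hh & Hf).
  exists (List.map (fun p => (a * fst p, snd p)) l), (fun eps => a * h eps); repeat split.
  - apply Forall_map; exact Hl.
  - now apply filterlim_scal_0.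
  - intros eps Heps; rewrite lin_comb_scal, Hf by exact Heps; ring.
Qed.

Lemma is_Nlim_unique f a b : is_Nlim f a -> is_Nlim f b -> a = b.
Proof.
  intros Ha Hb.
  enough (a - b = 0) by lra.
  apply negligible_const.
  apply negligible_ext with (fun eps => (f eps - b) + (-1) * (f eps - a));
    [intros; ring|].
  apply negligible_plus; [exact Hb | now apply negligible_scal].
Qed.

(** Existence makes the value chosen by [epsilon] a neutrix limit; uniqueness identifies it with
    [c]. *)
Lemma Nlim_eq f c : is_Nlim f c -> Nlim f = c.
Proof.
  intros Hc; apply (is_Nlim_unique f); [|exact Hc].
  exact (epsilon_spec (inhabits 0) (is_Nlim f) (ex_intro _ c Hc)).
Qed.

Lemma is_Nlim_plus f g a b :
  is_Nlim f a -> is_Nlim g b -> is_Nlim (fun eps => f eps + g eps) (a + b).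
Proof.
  intros Hf Hg.
  apply negligible_ext with (fun eps => (f eps - a) + (g eps - b)); [intros; ring|].
  now apply negligible_plus.
Qed.

(** * The neutrix limit of the polygamma integral *)

Definition power_log (n : nat) (x t : R) : R := Rpower t (x - 1) * ln t ^ n.

(** Repeated integration by parts, each lowering the power of the logarithm by one; a primitive for
    [x <> 0]. *)
Fixpoint power_log_prim (n : nat) (x t : R) : R :=
  match n with
  | O => Rpower t x / x
  | S k => Rpower t x * ln t ^ S k / x - INR (S k) / x * power_log_prim k x t
  end.

Lemma Rpower_pred t x : 0 < t -> Rpower t (x - 1) = Rpower t x / t.
Proof.
  intros Ht; unfold Rminus; rewrite Rpower_plus, Rpower_Ropp, Rpower_1 by exact Ht.
  reflexivity.
Qed.

Lemma power_log_continuous n x t : 0 < t -> continuous (power_log n x) t.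
Proof.
  intros Ht; apply (ex_derive_continuous (power_log n x)); unfold power_log, Rpower.
  auto_derive; auto.
Qed.

Lemma power_log_prim_derive n x t :
  x <> 0 -> 0 < t -> is_derive (power_log_prim n x) t (power_log n x t).
Proof.
  intros Hx Ht; unfold power_log; rewrite Rpower_pred by exact Ht.
  induction n as [|k IH]; cbn [power_log_prim].
  - unfold Rpower; auto_derive; [exact Ht | field; split; lra].
  - assert (Hlead : is_derive (fun t => Rpower t x * ln t ^ S k / x) t
      (Rpower t x / t * ln t ^ S k + INR (S k) / x * (Rpower t x / t * ln t ^ k))).
    { unfold Rpower; auto_derive; [auto|].
      change (match k with O => 1 | S _ => INR k + 1 end) with (INR (S k)).
      simpl Nat.pred; rewrite <- tech_pow_Rmult; field; split; lra. }
    pose proof (is_derive_minus _ _ _ _ _ Hlead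
      (is_derive_scal (power_log_prim k x) t (INR (S k) / x) _ IH)) as Hminus.
    replace (Rpower t x / t * ln t ^ S k) with
      (minus (Rpower t x / t * ln t ^ S k + INR (S k) / x * (Rpower t x / t * ln t ^ k))
         (INR (S k) / x * (Rpower t x / t * ln t ^ k))); [exact Hminus|].
    unfold minus, plus, opp; cbn -[INR pow]; ring.
Qed.

Lemma power_log_RInt n x eps :
  x <> 0 -> 0 < eps < 1 ->
  is_RInt (power_log n x) eps 1 (power_log_prim n x 1 - power_log_prim n x eps).
Proof.
  intros Hx Heps.
  apply (is_RInt_derive (power_log_prim n x));
    rewrite Rmin_left, Rmax_right by lra; intros t Ht.
  - apply power_log_prim_derive; lra.
  - apply power_log_continuous; lra.
Qed.

(** The exponent 0, where the division by [x] fails: the integrand is [ln^n t / t], with a power of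
    the logarithm as primitive. *)
Lemma power_log_RInt_0 n eps :
  0 < eps < 1 -> is_RInt (power_log n 0) eps 1 (- (ln eps ^ S n / INR (S n))).
Proof.
  intros Heps.
  replace (- _) with (ln 1 ^ S n / INR (S n) - ln eps ^ S n / INR (S n))
    by (rewrite ln_1, pow_ne_zero by lia; unfold Rdiv; ring).
  apply (is_RInt_derive (fun t => ln t ^ S n / INR (S n)));
    rewrite Rmin_left, Rmax_right by lra; intros t Ht.
  - unfold power_log.
    rewrite Rpower_pred, Rpower_O by lra.
    auto_derive; [lra|].
    change (match n with O => 1 | S _ => INR n + 1 end) with (INR (S n)).
    simpl Nat.pred; field; split; [lra | apply not_0_INR; lia].
  - apply power_log_continuous; lra.
Qed.

(** Since [ln 1 = 0], only the recursive term survives, and each level contributes a factor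
    [- INR (S k) / x]. *)
Lemma power_log_prim_1 n x :
  x <> 0 -> power_log_prim n x 1 = (-1) ^ n * INR (fact n) / x ^ (n + 1).
Proof.
  intros Hx; induction n as [|k IH]; cbn [power_log_prim].
  - unfold Rpower; rewrite ln_1, Rmult_0_r, exp_0.
    simpl; field; exact Hx.
  - rewrite IH, ln_1, pow_ne_zero, fact_simpl, mult_INR by lia.
    replace (S k + 1)%nat with (S (k + 1)) by lia.
    rewrite <- !tech_pow_Rmult; field; split; [now apply pow_nonzero | exact Hx].
Qed.

Lemma power_log_prim_negligible n x : x < 0 -> negligible (power_log_prim n x).
Proof.
  intros Hx.
  assert (Hgen : forall k c, negligible (fun t => c * (Rpower t x * ln t ^ k))).
  { intros k c; apply negligible_scal, negligible_generator.
    (* A generator carries the power [r - 1], hence [r = k + 1]. *)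
    replace k with (S k - 1)%nat by lia.
    apply (neutrix_generator_pow_ln x (S k)); [exact Hx | lia]. }
  induction n as [|k IH]; cbn [power_log_prim].
  - apply negligible_ext with (2 := Hgen 0%nat (/ x)); intros; simpl; field; lra.
  - apply negligible_ext with
      (fun t => / x * (Rpower t x * ln t ^ S k) + - (INR (S k) / x) * power_log_prim k x t).
    + intros; unfold Rdiv; ring.
    + apply negligible_plus; [apply Hgen | now apply negligible_scal].
Qed.

(** * Limits at 0 for positive exponents *)

Lemma Rpower_lim0 x : 0 < x -> filterlim (fun t => Rpower t x) (at_right 0) (locally 0).
Proof.
  intros Hx; apply filterlim_locally; intros [e He]; simpl.
  exists (mkposreal (exp (ln e / x)) (exp_pos _)); intros t Hball Ht.
  change (Rabs (t - 0) < exp (ln e / x)) in Hball.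
  change (Rabs (Rpower t x - 0) < e).
  rewrite Rminus_0_r in *; rewrite Rabs_pos_eq in * by (try (left; apply exp_pos); lra).
  unfold Rpower; rewrite <- (exp_ln e) by exact He.
  apply exp_increasing.
  apply ln_increasing in Hball; [|exact Ht]; rewrite ln_exp in Hball.
  apply (Rmult_lt_compat_l x) in Hball; [|exact Hx].
  replace (x * (ln e / x)) with (ln e) in Hball by (field; lra); exact Hball.
Qed.

Lemma at_right_0_lt d : 0 < d -> at_right 0 (fun t => 0 < t < d).
Proof.
  intros Hd; exists (mkposreal d Hd); intros t Ht H0.
  change (Rabs (t - 0) < d) in Ht; rewrite Rminus_0_r, Rabs_pos_eq in Ht by lra; lra.
Qed.

(** The inequality [1 + u <= exp u] at [u = - (x / 2) * ln t] bounds [- ln t] by [(2 / x) t^(-x/2)],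
    which squeezes the product between [- (2 / x) t^(x/2)] and 0. *)
Lemma Rpower_ln_lim0 x :
  0 < x -> filterlim (fun t => Rpower t x * ln t) (at_right 0) (locally 0).
Proof.
  intros Hx.
  apply (filterlim_le_le (fun t => - (2 / x) * Rpower t (x / 2)) _ (fun _ => 0) (Finite 0)).
  - apply filter_imp with (2 := at_right_0_lt 1 Rlt_0_1); intros t Ht.
    assert (Hln : ln t < 0) by (rewrite <- ln_1; apply ln_increasing; lra).
    assert (Hpos : 0 < Rpower t x) by apply exp_pos.
    split; [|nra].
    pose proof (exp_ineq1_le (- (x / 2) * ln t)) as Hexp.
    change (exp (- (x / 2) * ln t)) with (Rpower t (- (x / 2))) in Hexp.
    replace (x / 2) with (x + - (x / 2)) at 1 by field; rewrite Rpower_plus.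
    apply Rle_trans with (Rpower t x * (- (2 / x) * Rpower t (- (x / 2)))); [right; ring|].
    apply Rmult_le_compat_l; [lra|].
    apply (Rmult_le_reg_l (x / 2)); [lra|].
    replace (x / 2 * (- (2 / x) * Rpower t (- (x / 2)))) with (- Rpower t (- (x / 2)))
      by (field; lra).
    lra.
  - apply (filterlim_scal_0 (- (2 / x))), Rpower_lim0; lra.
  - apply filterlim_const.
Qed.

Lemma Rpower_pow_ln_lim0 n x :
  0 < x -> filterlim (fun t => Rpower t x * ln t ^ n) (at_right 0) (locally 0).
Proof.
  revert x; induction n as [|n IH]; intros x Hx.
  - apply filterlim_ext with (2 := Rpower_lim0 x Hx); intros t; simpl; ring.
  - assert (Hx2 : 0 < x / 2) by lra.
    refine (filterlim_ext _ _ _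
      (filterlim_mult_0 _ _ (IH (x / 2) Hx2) (Rpower_ln_lim0 (x / 2) Hx2))).
    (* Half of the exponent absorbs one logarithm, the other half the remaining [n]. *)
    intros t; replace x with (x / 2 + x / 2) at 3 by field; rewrite Rpower_plus; simpl; ring.
Qed.

Lemma power_log_prim_lim0 n x :
  0 < x -> filterlim (power_log_prim n x) (at_right 0) (locally 0).
Proof.
  intros Hx; induction n as [|k IH]; cbn [power_log_prim].
  - refine (filterlim_ext _ _ _ (filterlim_scal_0 (/ x) _ (Rpower_lim0 x Hx))).
    intros t; apply Rmult_comm.
  - pose proof (filterlim_plus_0 _ _
      (filterlim_scal_0 (/ x) _ (Rpower_pow_ln_lim0 (S k) x Hx))
      (filterlim_scal_0 (- (INR (S k) / x)) _ IH)) as Hlim.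
    revert Hlim; apply filterlim_ext; intros t.
    change (/ x * (Rpower t x * ln t ^ S k) + - (INR (S k) / x) * power_log_prim k x t
      = Rpower t x * ln t ^ S k / x - INR (S k) / x * power_log_prim k x t :> R).
    unfold Rdiv; ring.
Qed.

(* The value at [t = 1] is the limit of [ln t / (1 - t)], not Rocq's [0 / 0]. *)
Definition ln_quotient (t : R) : R :=
  if Req_EM_T t 1 then -1 else ln t / (1 - t).

(** At 1 this is the derivative of [ln]: the quotient is minus the difference quotient of [ln] at
    1. *)
Lemma ln_quotient_continuous t : 0 < t -> continuous ln_quotient t.
Proof.
  intros Ht; destruct (Req_dec t 1) as [-> | Hne].
  - apply filterlim_locally; intros e.
    destruct (derivable_pt_lim_ln 1 Rlt_0_1 e (cond_pos e)) as [d Hd].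
    exists d.
    change (forall y : R, Rabs (y - 1) < d -> Rabs (ln_quotient y - ln_quotient 1) < e).
    intros y Hy.
    unfold ln_quotient at 2; destruct (Req_EM_T 1 1) as [_ | H]; [|congruence].
    unfold ln_quotient; destruct (Req_EM_T y 1) as [_ | Hy1].
    + rewrite Rminus_diag, Rabs_R0; apply cond_pos.
    + specialize (Hd (y - 1) ltac:(lra) Hy).
      rewrite <- Rabs_Ropp.
      replace (- _) with ((ln (1 + (y - 1)) - ln 1) / (y - 1) - / 1); [exact Hd|].
      rewrite ln_1; replace (1 + (y - 1)) with y by ring.
      field; split; lra.
  - apply continuous_ext_loc with (fun t => ln t / (1 - t)).
    + assert (Hpos : 0 < Rabs (t - 1)) by (apply Rabs_pos_lt; lra).
      exists (mkposreal _ Hpos); intros y Hy.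
      change (Rabs (y - t) < Rabs (t - 1)) in Hy.
      unfold ln_quotient; destruct (Req_EM_T y 1) as [-> | _]; [|reflexivity].
      rewrite Rabs_minus_sym in Hy; lra.
    + apply (ex_derive_continuous (fun t => ln t / (1 - t))); auto_derive; lra.
Qed.

(** * Integrability, recursion and a uniform bound *)

Definition polygamma_integrand (n : nat) (x t : R) : R :=
  Rpower t (x - 1) / (1 - t) * ln t ^ n.

(** As [1 <= n], one logarithm can be paired with [1 / (1 - t)]; the integrand then agrees on the
    open interval with a function continuous up to 1. *)
Lemma polygamma_integrand_ex_RInt n x eps :
  (1 <= n)%nat -> 0 < eps < 1 -> ex_RInt (polygamma_integrand n x) eps 1.
Proof.
  intros Hn Heps.
  apply ex_RInt_ext with (fun t => power_log (n - 1) x t * ln_quotient t).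
  - rewrite Rmin_left, Rmax_right by lra; intros t Ht.
    unfold ln_quotient; destruct (Req_EM_T t 1) as [H | _]; [lra|].
    unfold polygamma_integrand, power_log.
    replace n with (S (n - 1)) at 2 by lia; simpl; field; lra.
  - apply (ex_RInt_continuous (V := R_CompleteNormedModule)).
    rewrite Rmin_left, Rmax_right by lra; intros t Ht.
    apply (continuous_mult (power_log (n - 1) x) ln_quotient).
    + apply power_log_continuous; lra.
    + apply ln_quotient_continuous; lra.
Qed.

Lemma polygamma_integral_is_RInt n x eps :
  (1 <= n)%nat -> 0 < eps < 1 ->
  is_RInt (polygamma_integrand n x) eps 1 (polygamma_integral n x eps).
Proof.
  intros Hn Heps.
  exact (RInt_correct _ _ _ (polygamma_integrand_ex_RInt n x eps Hn Heps)).
Qed.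

(* [t^(x-1) / (1 - t) = t^(x-1) + t^x / (1 - t)] *)
Lemma polygamma_integral_rec n x eps l :
  (1 <= n)%nat -> 0 < eps < 1 -> is_RInt (power_log n x) eps 1 l ->
  polygamma_integral n x eps = l + polygamma_integral n (x + 1) eps.
Proof.
  intros Hn Heps Hl.
  apply (is_RInt_unique (V := R_CompleteNormedModule)).
  apply (is_RInt_ext (V := R_NormedModule)) with
    (fun t => plus (power_log n x t) (polygamma_integrand n (x + 1) t)).
  - rewrite Rmin_left, Rmax_right by lra; intros t Ht.
    change (power_log n x t + polygamma_integrand n (x + 1) t
      = Rpower t (x - 1) / (1 - t) * ln t ^ n).
    unfold power_log, polygamma_integrand.
    replace (x + 1 - 1) with x by ring; rewrite Rpower_pred by lra.
    field; lra.
  - apply (is_RInt_plus (V := R_NormedModule)); [exact Hl|].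
    now apply polygamma_integral_is_RInt.
Qed.

(** From [- ln t <= / t - 1], one logarithm and [1 / (1 - t)] together cost at most a factor
    [1 / t]. What remains is [t^(x-1) |ln t|^n], whose integral over (0,1) is the bound. *)
Lemma polygamma_integral_bound n x eps :
  0 < x -> 0 < eps < 1 ->
  Rabs (polygamma_integral (S n) (x + 1) eps) <= INR (fact n) / x ^ (n + 1).
Proof.
  intros Hx Heps.
  assert (Hsgn : forall k t, (-1) ^ k * ln t ^ k = (- ln t) ^ k).
  { intros k t; rewrite <- Rpow_mult_distr; f_equal; ring. }
  assert (Hln : forall t, 0 < t <= 1 -> 0 <= - ln t).
  { intros t Ht; pose proof (ln_le t 1 ltac:(lra) ltac:(lra)); rewrite ln_1 in *; lra. }
  (* With the sign [(-1) ^ k] the primitive is nonnegative at [eps], so dropping that endpoint only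
     increases the bound. *)
  assert (Hprim : forall k, 0 <= (-1) ^ k * power_log_prim k x eps).
  { assert (Hinv : 0 < / x) by now apply Rinv_0_lt_compat.
    assert (Hpos : 0 < Rpower eps x) by apply exp_pos.
    induction k as [|k IH]; cbn [power_log_prim].
    - rewrite pow_O, Rmult_1_l; left; now apply Rdiv_lt_0_compat.
    - replace (_ * _) with (/ x * (Rpower eps x * (- ln eps) ^ S k
                            + INR (S k) * ((-1) ^ k * power_log_prim k x eps)))
        by (rewrite <- Hsgn; simpl; unfold Rdiv; ring).
      apply Rmult_le_pos; [lra|]; apply Rplus_le_le_0_compat; apply Rmult_le_pos;
        [lra | apply pow_le, Hln; lra | apply pos_INR | exact IH]. }
  apply Rle_trans with ((-1) ^ n * (power_log_prim n x 1 - power_log_prim n x eps)).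
  - apply (norm_RInt_le (V := R_NormedModule)
      (polygamma_integrand (S n) (x + 1)) (fun t => (-1) ^ n * power_log n x t) eps 1).
    + lra.
    + intros t Ht.
      change (Rabs (polygamma_integrand (S n) (x + 1) t) <= (-1) ^ n * power_log n x t).
      assert (Hpos : 0 < Rpower t x) by apply exp_pos.
      assert (Hpow : 0 <= (- ln t) ^ n) by (apply pow_le, Hln; lra).
      unfold polygamma_integrand, power_log.
      replace (_ ^ n * _) with (Rpower t (x - 1) * (- ln t) ^ n) by (rewrite <- Hsgn; ring).
      rewrite (Rpower_pred t x) by lra.
      (* At [t = 1] the power of [ln t] vanishes, whatever value the division by 0 has. *)
      destruct (Req_dec t 1) as [-> | Hne].
      * rewrite ln_1 in *; simpl pow; rewrite Rmult_0_l, Rmult_0_r, Rabs_R0.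
        apply Rmult_le_pos; [left; apply Rdiv_lt_0_compat; lra | exact Hpow].
      * replace (x + 1 - 1) with x by ring.
        rewrite Rabs_mult, <- RPow_abs, (Rabs_left1 (ln t)) by (specialize (Hln t); lra).
        assert (Hquot : 0 < Rpower t x / (1 - t)) by (apply Rdiv_lt_0_compat; lra).
        rewrite Rabs_pos_eq by lra.
        rewrite <- tech_pow_Rmult, <- Rmult_assoc.
        apply Rmult_le_compat_r; [exact Hpow|].
        replace (Rpower t x / t) with (Rpower t x / (1 - t) * (/ t - 1)) by (field; lra).
        apply Rmult_le_compat_l; [lra|].
        pose proof (exp_ineq1_le (- ln t)) as Hexp.
        rewrite exp_Ropp, exp_ln in Hexp; lra.
    + apply polygamma_integral_is_RInt; [lia | exact Heps].
    + apply (is_RInt_scal (V := R_NormedModule)), power_log_RInt; lra.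
  - specialize (Hprim n).
    rewrite Rmult_minus_distr_l, power_log_prim_1 by lra.
    replace (_ * (_ / _)) with (((-1) * (-1)) ^ n * (INR (fact n) / x ^ (n + 1)))
      by (rewrite Rpow_mult_distr; unfold Rdiv; ring).
    replace (-1 * -1) with 1 by ring; rewrite pow1; lra.
Qed.

(** * The zeta series and the integral at [x = 1] *)

(** Telescoping: with [y = N + 1], the next term is at most
    [1 / (y (y + 1)) = 1 / y - 1 / (y + 1)]. *)
Lemma ex_series_zeta n :
  (1 <= n)%nat -> ex_series (fun k => / INR (S k) ^ (n + 1)).
Proof.
  intros Hn.
  assert (Hsum : forall N, sum_n (fun k => / INR (S k) ^ (n + 1)) N <= 2 - / INR (S N)).
  { induction N as [|N IH].
    - rewrite sum_O; simpl INR; rewrite pow1; lra.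
    - rewrite sum_Sn; change plus with Rplus.
      enough (/ INR (S (S N)) ^ (n + 1) <= / INR (S N) - / INR (S (S N))) by lra.
      pose proof (lt_0_INR (S N) ltac:(lia)) as Hpos.
      rewrite (S_INR (S N)); set (y := INR (S N)) in *.
      replace (/ y - / (y + 1)) with (/ (y * (y + 1))) by (field; lra).
      apply Rinv_le_contravar; [nra|].
      apply Rle_trans with ((y + 1) ^ 2); [nra|].
      apply Rle_pow; [lra | lia]. }
  destruct (ex_finite_lim_seq_incr (sum_n (fun k => / INR (S k) ^ (n + 1))) 2) as [l Hl].
  - intros N; rewrite sum_Sn; change plus with Rplus.
    enough (0 < / INR (S (S N)) ^ (n + 1)) by lra.
    apply Rinv_0_lt_compat, pow_lt, lt_0_INR; lia.
  - intros N; specialize (Hsum N).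
    pose proof (Rinv_0_lt_compat _ (lt_0_INR (S N) ltac:(lia))); lra.
  - now exists l.
Qed.

Lemma zeta_is_series n :
  (1 <= n)%nat ->
  is_series (fun k => / INR (S k) ^ (n + 1)) (zeta (INR (n + 1))).
Proof.
  intros Hn; unfold zeta.
  rewrite (Series_ext _ (fun k => / INR (S k) ^ (n + 1))).
  - now apply Series_correct, ex_series_zeta.
  - intros k; rewrite Rpower_pow; [reflexivity | apply lt_0_INR; lia].
Qed.

(** The recursion iterated from [x = 1]. As [sum_n] up to [N] has [N + 1] terms, the remainder sits
    at [INR (S N) + 1]. *)
Lemma polygamma_integral_expand n eps N :
  (1 <= n)%nat -> 0 < eps < 1 ->
  polygamma_integral n 1 eps =
    sum_n (fun k => power_log_prim n (INR (S k)) 1) N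
    - sum_n (fun k => power_log_prim n (INR (S k)) eps) N
    + polygamma_integral n (INR (S N) + 1) eps.
Proof.
  intros Hn Heps; induction N as [|N IH].
  - rewrite !sum_O.
    apply polygamma_integral_rec; [exact Hn | exact Heps|].
    apply power_log_RInt; [simpl; lra | exact Heps].
  - rewrite IH, !sum_Sn; change plus with Rplus.
    rewrite <- S_INR, (polygamma_integral_rec n (INR (S (S N))) eps
      (power_log_prim n (INR (S (S N))) 1 - power_log_prim n (INR (S (S N))) eps) Hn Heps).
    + ring.
    + apply power_log_RInt; [apply not_0_INR; lia | exact Heps].
Qed.

(** [N] is fixed first, so that the tail of the series and the remainder are below [e / 3], the
    latter for every [eps] in (0,1). Only then does [eps] tend to 0 in the finitely many
    primitives. *)
Lemma polygamma_integral_1_lim n :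
  (1 <= n)%nat ->
  filterlim (polygamma_integral n 1) (at_right 0)
    (locally ((-1) ^ n * INR (fact n) * zeta (INR (n + 1)))).
Proof.
  intros Hn; set (c := (-1) ^ n * INR (fact n)).
  apply filterlim_locally; intros [e He].
  assert (Hser : is_lim_seq (sum_n (fun k => power_log_prim n (INR (S k)) 1))
                   (Finite (c * zeta (INR (n + 1))))).
  { apply (is_lim_seq_ext (fun N => c * sum_n (fun k => / INR (S k) ^ (n + 1)) N)).
    - intros N.
      etransitivity; [symmetry; apply (sum_n_mult_l (K := R_Ring) c)|].
      apply sum_n_ext; intros k.
      rewrite power_log_prim_1 by (apply not_0_INR; lia); reflexivity.
    - apply (is_lim_seq_scal_l _ c (Finite (zeta (INR (n + 1))))).
      exact (zeta_is_series n Hn). }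
  assert (Hinv : is_lim_seq (fun N => INR (fact (n - 1)) * / INR (S N)) (Finite 0)).
  { replace (Finite 0) with (Rbar_mult (INR (fact (n - 1))) (Rbar_inv p_infty))
      by (simpl; f_equal; ring).
    apply is_lim_seq_scal_l, is_lim_seq_inv; [|discriminate].
    apply -> is_lim_seq_incr_1; apply is_lim_seq_INR. }
  apply is_lim_seq_spec in Hser; apply is_lim_seq_spec in Hinv.
  assert (He3 : 0 < e / 3) by lra.
  destruct (Hser (mkposreal _ He3)) as [N1 HN1].
  destruct (Hinv (mkposreal _ He3)) as [N2 HN2].
  set (N := max N1 N2).
  specialize (HN1 N ltac:(lia)); specialize (HN2 N ltac:(lia)); cbn [pos] in HN1, HN2.
  assert (Hprim : filterlim (fun eps => sum_n (fun k => power_log_prim n (INR (S k)) eps) N)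
                    (at_right 0) (locally 0)).
  { clear HN1 HN2; induction N as [|N IH].
    - refine (filterlim_ext _ _ _ (power_log_prim_lim0 n (INR 1) Rlt_0_1)).
      intros t; now rewrite sum_O.
    - refine (filterlim_ext _ _ _ (filterlim_plus_0 _ _ IH
        (power_log_prim_lim0 n (INR (S (S N))) (lt_0_INR (S (S N)) (Nat.lt_0_succ _))))).
      intros t; now rewrite sum_Sn. }
  generalize (filter_and _ _ (proj1 (filterlim_locally _ _) Hprim (mkposreal _ He3))
    (at_right_0_lt 1 Rlt_0_1)); apply filter_imp.
  intros t [Hsum Ht].
  change (Rabs (sum_n (fun k => power_log_prim n (INR (S k)) t) N - 0) < e / 3) in Hsum.
  change (Rabs (polygamma_integral n 1 t - c * zeta (INR (n + 1))) < e).
  rewrite (polygamma_integral_expand n t N Hn Ht).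
  (* The uniform bound at index [n - 1] is [(n-1)! / (N+1)^n], at most [(n-1)! / (N+1)] because
     [1 <= n]. *)
  assert (Hrem : Rabs (polygamma_integral n (INR (S N) + 1) t) < e / 3).
  { assert (HN : 1 <= INR (S N)) by (apply (le_INR 1); lia).
    eapply Rle_lt_trans; [|eapply Rle_lt_trans; [apply Rle_abs | exact HN2]].
    replace n with (S (n - 1)) at 1 by lia.
    eapply Rle_trans; [apply polygamma_integral_bound; [lra | exact Ht]|].
    rewrite Rminus_0_r; apply Rmult_le_compat_l; [apply pos_INR|].
    apply Rinv_le_contravar; [lra|].
    rewrite <- (pow_1 (INR (S N))) at 1; apply Rle_pow; [exact HN | lia]. }
  apply Rabs_def2 in HN1, Hsum, Hrem; apply Rabs_def1; lra.
Qed.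

(** * Neutrix limits at the nonpositive integers *)

Lemma is_Nlim_ext f g c :
  (forall eps, 0 < eps < 1 / 2 -> f eps = g eps) -> is_Nlim f c -> is_Nlim g c.
Proof.
  intros Heq; apply negligible_ext; intros eps Heps; now rewrite Heq.
Qed.

(** One step of the recursion separates 0 from 1, at the cost of a multiple of the generator
    [ln eps ^ S n], which is negligible. *)
Lemma is_Nlim_polygamma_integral_0 n :
  (1 <= n)%nat ->
  is_Nlim (polygamma_integral n 0) ((-1) ^ n * INR (fact n) * zeta (INR (n + 1))).
Proof.
  intros Hn; set (c := _ * zeta _).
  apply is_Nlim_ext with
    (fun eps => - (ln eps ^ S n / INR (S n)) + polygamma_integral n 1 eps).
  { intros eps Heps; rewrite <- (Rplus_0_l 1); symmetry.
    apply polygamma_integral_rec; [exact Hn | lra | apply power_log_RInt_0; lra]. }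
  rewrite <- (Rplus_0_l c); apply is_Nlim_plus.
  - apply negligible_ext with (fun eps => - / INR (S n) * ln eps ^ S n).
    + intros; unfold Rdiv; ring.
    + apply negligible_scal, negligible_generator, neutrix_generator_ln; lia.
  - now apply is_Nlim_lim, polygamma_integral_1_lim.
Qed.

Lemma is_Nlim_polygamma_integral n m :
  (1 <= n)%nat ->
  is_Nlim (polygamma_integral n (- INR m))
    ((-1) ^ n * INR (fact n) * zeta (INR (n + 1))
     - sum_n_m (fun i => INR (fact n) / INR i ^ (n + 1)) 1 m).
Proof.
  intros Hn; induction m as [|m IH].
  - rewrite sum_n_m_zero by lia; simpl (INR 0); rewrite Ropp_0.
    replace (_ - _) with ((-1) ^ n * INR (fact n) * zeta (INR (n + 1)))
      by (change zero with 0; ring).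
    now apply is_Nlim_polygamma_integral_0.
  - pose proof (lt_0_INR (S m) ltac:(lia)) as Hpos.
    rewrite sum_n_Sm by lia; change plus with Rplus.
    set (x := - INR (S m)).
    apply is_Nlim_ext with (fun eps =>
      (power_log_prim n x 1 + - 1 * power_log_prim n x eps) + polygamma_integral n (- INR m) eps).
    { intros eps Heps.
      replace (- INR m) with (x + 1) by (unfold x; rewrite S_INR; ring).
      symmetry; apply polygamma_integral_rec; [exact Hn | lra|].
      replace (-1 * power_log_prim n x eps) with (- power_log_prim n x eps) by ring.
      apply power_log_RInt; unfold x; lra. }
    replace (_ - _) with (- (INR (fact n) / INR (S m) ^ (n + 1)) +
      ((-1) ^ n * INR (fact n) * zeta (INR (n + 1))
       - sum_n_m (fun i => INR (fact n) / INR i ^ (n + 1)) 1 m)) by ring.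
    apply is_Nlim_plus; [|exact IH].
    apply negligible_ext with (fun eps => -1 * power_log_prim n x eps).
    + intros eps _; rewrite power_log_prim_1 by (unfold x; lra).
      (* The sign [(-1)^(n+1)] of [x ^ (n + 1)] meets the [(-1) ^ n] of [power_log_prim_1], so each
         new term is negative for every [n]. *)
      replace (x ^ (n + 1)) with (- ((-1) ^ n * INR (S m) ^ (n + 1))).
      * field; split; apply pow_nonzero; lra.
      * unfold x; replace (- INR (S m)) with (-1 * INR (S m)) by ring.
        rewrite Rpow_mult_distr, (pow_add (-1)); ring.
    + apply negligible_scal, power_log_prim_negligible; unfold x; lra.
Qed.

Theorem theorem2p4 (n m : nat) (hn : (1 <= n)%nat) :
  ex_Nlim (polygamma_integral n (- INR m)) /\
  polygamma n (- INR m) =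
    sum_n_m (fun i => INR (fact n) / INR i ^ (n + 1)) 1 m
    + (-1) ^ (n + 1) * INR (fact n) * zeta (INR (n + 1)).
Proof.
  pose proof (is_Nlim_polygamma_integral n m hn) as Hlim.
  split; [now eexists; exact Hlim|].
  unfold polygamma; rewrite (Nlim_eq _ _ Hlim), pow_add; ring.
Qed.
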